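(* Let $A=\mathbf{e_1}A_{\hat 1}+\mathbf{e_2}A_{\hat 2}$ be an $n\times n$ bicomplex matrix, where $A_{\hat 1},A_{\hat 2}$ are $n\times n$ matrices with entries in $\mathbb{C}(\mathbf{i_1})$. Then $\det(A)=\mathbf{e_1}\det(A_{\hat 1})+\mathbf{e_2}\det(A_{\hat 2})$.
   Context: Bicomplex numbers: $\mathbb{T}$ is the commutative ring of elements $w=z_1+z_2\mathbf{i_2}$ with $z_1,z_2\in\mathbb{C}(\mathbf{i_1})=\{x+y\mathbf{i_1}: x,y\in\mathbb{R}\}$ (a copy of the complex field), where $\mathbf{i_1}^2=\mathbf{i_2}^2=-1$ and $\mathbf{i_1}\mathbf{i_2}=\mathbf{i_2}\mathbf{i_1}=\mathbf{j}$, so $\mathbf{j}^2=1$. Put $\mathbf{e_1}=(1+\mathbf{j})/2$, $\mathbf{e_2}=(1-\mathbf{j})/2$; then $\mathbf{e_k}^2=\mathbf{e_k}$, $\mathbf{e_1}\mathbf{e_2}=0$, $\mathbf{e_1}+\mathbf{e_2}=1$, and every $w\in\mathbb{T}$ is uniquely $w=\mathbf{e_1}w_{\hat 1}+\mathbf{e_2}w_{\hat 2}$ with $w_{\hat 1},w_{\hat 2}\in\mathbb{C}(\mathbf{i_1})$. A bicomplex $n\times n$ matrix is a matrix with entries in $\mathbb{T}$; decomposing each entry this way gives the unique decomposition $A=\mathbf{e_1}A_{\hat 1}+\mathbf{e_2}A_{\hat 2}$. *)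

(* Defs.v *)
From HB Require Import structures.
From mathcomp Require Import all_boot all_order all_algebra.
From mathcomp Require Import reals complex ring.

Set Implicit Arguments.
Unset Strict Implicit.
Unset Printing Implicit Defensive.

Import GRing.Theory.
Local Open Scope ring_scope.

(* C(i1) is [R[i]]; [Bicomplex z1 z2] stands for z1 + z2 i2. A record is used
   because the pair type [R[i] * R[i]] already carries the componentwise
   product ring structure, whose multiplication is a different one. *)
Record bicomplex (R : realType) := Bicomplex { bc1 : R[i]; bc2 : R[i] }.

Section BicomplexRing.
Variable R : realType.
Local Notation T := (bicomplex R).
Implicit Types u v w : T.

Definition bc_pair w : R[i] * R[i] := (bc1 w, bc2 w).
Definition pair_bc (p : R[i] * R[i]) : T := Bicomplex p.1 p.2.

Lemma bc_pairK : cancel bc_pair pair_bc.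
Proof. by case. Qed.

HB.instance Definition _ := Choice.copy T (can_type bc_pairK).

Definition bc_zero : T := Bicomplex 0 0.
Definition bc_one : T := Bicomplex 1 0.
Definition bc_opp w : T := Bicomplex (- bc1 w) (- bc2 w).
Definition bc_add v w : T := Bicomplex (bc1 v + bc1 w) (bc2 v + bc2 w).
Definition bc_mul v w : T :=
  Bicomplex (bc1 v * bc1 w - bc2 v * bc2 w) (bc1 v * bc2 w + bc2 v * bc1 w).

Lemma bc_addA : associative bc_add.
Proof. by move=> u v w; rewrite /bc_add /= !addrA. Qed.

Lemma bc_addC : commutative bc_add.
Proof. by move=> v w; congr Bicomplex; rewrite addrC. Qed.

Lemma bc_add0 : left_id bc_zero bc_add.
Proof. by case=> a b; rewrite /bc_add /= !add0r. Qed.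

Lemma bc_addN : left_inverse bc_zero bc_opp bc_add.
Proof. by move=> w; rewrite /bc_add /= !addNr. Qed.

HB.instance Definition _ :=
  GRing.isZmodule.Build T bc_addA bc_addC bc_add0 bc_addN.

Lemma bc_mulA : associative bc_mul.
Proof. by move=> u v w; congr Bicomplex => /=; ring. Qed.

Lemma bc_mulC : commutative bc_mul.
Proof. by move=> v w; congr Bicomplex => /=; ring. Qed.

Lemma bc_mul1 : left_id bc_one bc_mul.
Proof. by case=> a b; congr Bicomplex => /=; ring. Qed.

Lemma bc_mulD : left_distributive bc_mul bc_add.
Proof. by move=> u v w; congr Bicomplex => /=; ring. Qed.

Lemma bc_one_neq0 : bc_one != 0.
Proof. by apply/eqP => -[] /eqP; rewrite oner_eq0. Qed.

HB.instance Definition _ := GRing.Zmodule_isComNzRing.Build T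
  bc_mulA bc_mulC bc_mul1 bc_mulD bc_one_neq0.

Definition bc_embed (z : R[i]) : T := Bicomplex z 0.

Lemma bc_embed_is_zmod_morphism : zmod_morphism bc_embed.
Proof. by move=> x y; congr Bicomplex; rewrite /= subrr. Qed.

Lemma bc_embed_is_monoid_morphism : monoid_morphism bc_embed.
Proof. by split=> // x y; congr Bicomplex => /=; ring. Qed.

HB.instance Definition _ :=
  GRing.isZmodMorphism.Build R[i] T bc_embed bc_embed_is_zmod_morphism.
HB.instance Definition _ :=
  GRing.isMonoidMorphism.Build R[i] T bc_embed bc_embed_is_monoid_morphism.

Definition bc_i1 : T := bc_embed 'i%C.
Definition bc_i2 : T := Bicomplex 0 1.
Definition bc_j : T := bc_i1 * bc_i2.
Definition bc_e1 : T := bc_embed 2^-1 * (1 + bc_j).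
Definition bc_e2 : T := bc_embed 2^-1 * (1 - bc_j).

Lemma bc_eta w : w = bc_embed (bc1 w) + bc_embed (bc2 w) * bc_i2.
Proof. by case: w => a b; congr Bicomplex => /=; ring. Qed.

Lemma bc_i1_sqr : bc_i1 ^+ 2 = -1.
Proof. by rewrite -rmorphXn /= sqr_i rmorphN1. Qed.

Lemma bc_i2_sqr : bc_i2 ^+ 2 = -1.
Proof. by congr Bicomplex => /=; ring. Qed.

Lemma bc_j_sqr : bc_j ^+ 2 = 1.
Proof. by rewrite exprMn bc_i1_sqr bc_i2_sqr mulrNN mulr1. Qed.

Lemma bc_half2 : bc_embed 2^-1 * 2 = 1.
Proof.
have -> : 2 = bc_embed 2 by rewrite rmorph_nat.
rewrite -rmorphM /= mulVf ?rmorph1 //.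
by rewrite Num.Theory.pnatr_eq0.
Qed.

Lemma bc_e1De2 : bc_e1 + bc_e2 = 1.
Proof. by rewrite -bc_half2 /bc_e1 /bc_e2; ring. Qed.

Lemma bc_e1Me2 : bc_e1 * bc_e2 = 0.
Proof.
have -> : bc_e1 * bc_e2 = bc_embed 2^-1 ^+ 2 * (1 - bc_j ^+ 2).
  by rewrite /bc_e1 /bc_e2; ring.
by rewrite bc_j_sqr subrr mulr0.
Qed.

Lemma bc_e1_idem : bc_e1 * bc_e1 = bc_e1.
Proof. by rewrite -[RHS]mulr1 -bc_e1De2 mulrDr bc_e1Me2 addr0. Qed.

Lemma bc_e2_idem : bc_e2 * bc_e2 = bc_e2.
Proof. by rewrite -[RHS]mulr1 -bc_e1De2 mulrDr [bc_e2 * bc_e1]mulrC bc_e1Me2 add0r. Qed.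

Lemma bc_idem_decomp w :
  exists! p : R[i] * R[i], w = bc_e1 * bc_embed p.1 + bc_e2 * bc_embed p.2.
Proof.
have E x y : bc_e1 * bc_embed x + bc_e2 * bc_embed y =
    Bicomplex (2^-1 * (x + y)) (2^-1 * 'i%C * (x - y)).
  by congr Bicomplex => /=; ring.
have two0 : 2 != 0 :> R[i] by rewrite Num.Theory.pnatr_eq0.
have ii : 'i%C * 'i%C = -1 :> R[i] by rewrite -expr2 sqr_i.
have h x : x = 2^-1 * (x + x) :> R[i] by rewrite -mulr2n -[x *+ 2]mulr_natl mulKf.
case: w => a b; exists (a - 'i%C * b, a + 'i%C * b); split=> /=.
  rewrite E; congr Bicomplex; first by rewrite {1}(h a); congr (_ * _); ring.
  have -> : 2^-1 * 'i%C * (a - 'i%C * b - (a + 'i%C * b)) =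
     - ('i%C * 'i%C) * (2^-1 * (b + b)) by ring.
  by rewrite ii opprK mul1r -h.
case=> x y /=; rewrite E => -[-> ->]; congr pair.
  have -> : 2^-1 * (x + y) - 'i%C * (2^-1 * 'i%C * (x - y)) =
     2^-1 * ((x + y) - ('i%C * 'i%C) * (x - y)) by ring.
  by rewrite ii [RHS]h; congr (_ * _); ring.
have -> : 2^-1 * (x + y) + 'i%C * (2^-1 * 'i%C * (x - y)) =
   2^-1 * ((x + y) + ('i%C * 'i%C) * (x - y)) by ring.
by rewrite ii [RHS]h; congr (_ * _); ring.
Qed.

End BicomplexRing.

Arguments bc_i1 {R}.
Arguments bc_i2 {R}.
Arguments bc_j {R}.
Arguments bc_e1 {R}.
Arguments bc_e2 {R}.

(* Main.v *)
(* Multiplication by an element e of a commutative ring factors through the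
   quotient by the annihilator of e, so e * det M depends only on e *: M. For the
   bicomplex matrix A one has e1 *: A = e1 *: A1 and e2 *: A = e2 *: A2, and
   det A = e1 * det A + e2 * det A because e1 + e2 = 1. *)
Require Import Defs.
From mathcomp Require Import all_boot all_order all_algebra.
From mathcomp Require Import perm reals complex.

Import GRing.Theory.
Local Open Scope ring_scope.

Lemma mulr_det_eq {T : comNzRingType} {e : T} {n : nat} {M N : 'M[T]_n} :
  e *: M = e *: N -> e * \det M = e * \det N.
Proof.
move=> /matrixP eMN; rewrite /determinant !mulr_sumr; apply: eq_bigr => s _.
rewrite !(mulrCA e); congr (_ * _).
(* Congruence modulo the annihilator of [e] is compatible with products: the single [e] is passed
   from one factor to the next, replacing each in turn. *)
apply: (big_ind2 (fun x y => e * x = e * y)) => // [x x' y y' ex ey|i _].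
  by rewrite mulrA ex mulrAC ey mulrAC mulrA.
by have := eMN i (s i); rewrite !mxE.
Qed.

Theorem theorem3p1 (R : realType) (n : nat) (A : 'M[bicomplex R]_n)
    (A1 A2 : 'M[R[i]]_n)
    (hA : A = bc_e1 *: map_mx (@bc_embed R) A1 + bc_e2 *: map_mx (@bc_embed R) A2) :
  \det A = bc_e1 * bc_embed (\det A1) + bc_e2 * bc_embed (\det A2).
Proof.
(* Idempotence keeps one component; orthogonality kills the other. *)
have e1A : bc_e1 *: A = bc_e1 *: map_mx (@bc_embed R) A1.
  by rewrite hA scalerDr !scalerA bc_e1_idem bc_e1Me2 scale0r addr0.
have e2A : bc_e2 *: A = bc_e2 *: map_mx (@bc_embed R) A2.
  by rewrite hA scalerDr !scalerA bc_e2_idem (mulrC bc_e2) bc_e1Me2 scale0r add0r.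
(* The ring morphism [bc_embed] commutes with [\det], so both determinants are taken over the
   bicomplex ring, where each can be traded for [\det A]. *)
rewrite -!det_map_mx -(mulr_det_eq e1A) -(mulr_det_eq e2A).
by rewrite -mulrDl bc_e1De2 mul1r.
Qed.
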